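(* Let $L\subseteq\mathbb{R}^n$ be a linear subspace and let $H$ be the minimal lattice subspace of $\mathbb{R}^n$ containing $L$. Then $$\operatorname{cl}\bigl(\operatorname{proj}_{L^\perp}(\mathbb{Z}^n)\bigr)=(H+\mathbb{Z}^n)\cap L^\perp=(H\cap L^\perp)+\Lambda$$ for some lattice $\Lambda\subseteq L^\perp$ such that $\dim(H\cap L^\perp)+\dim(\Lambda)=\dim(L^\perp)$.
   Context: $\operatorname{cl}$ denotes topological closure, $L^\perp$ is the orthogonal complement of $L$ in $\mathbb{R}^n$, and $\operatorname{proj}_{L^\perp}$ is the orthogonal projection onto $L^\perp$. Sums of sets are Minkowski sums. A lattice of dimension $t$ is a set of the form $\{\lambda_1a_1+\dots+\lambda_ta_t : \lambda_1,\dots,\lambda_t\in\mathbb{Z}\}$, where $a_1,\dots,a_t\in\mathbb{R}^n$ are linearly independent (for $t=0$ it is $\{0\}$). A linear subspace $H\subseteq\mathbb{R}^n$ is a lattice subspace if $\dim(H\cap\mathbb{Z}^n)=\dim(H)$, i.e. if $H$ can be generated by a basis of integral vectors; equivalently, $H=\{x\in\mathbb{R}^n: Ax=0\}$ for some integral $(n-\dim H)\times n$ matrix $A$ of full row rank. Given a linear subspace $L\subseteq\mathbb{R}^n$, there is a unique minimal lattice subspace containing $L$, namely the intersection of all lattice subspaces containing $L$. *)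

(* Defs.v *)
From HB Require Import structures.
From mathcomp Require Import all_boot all_order all_algebra sesquilinear.
From mathcomp Require Import all_classical all_reals all_analysis.

Set Implicit Arguments.
Unset Strict Implicit.
Unset Printing Implicit Defensive.

Import Order.TTheory GRing.Theory Num.Theory.
Import numFieldNormedType.Exports.

Local Open Scope classical_set_scope.
Local Open Scope ring_scope.

Definition dotrv (R : realType) (n : nat) (u v : 'rV[R]_n) : R :=
  \sum_(i < n) u 0 i * v 0 i.

(* The instances below make dotrv a {dot 'rV[R]_n for idfun}, so that the
   theory of orthov applies to it. *)
Section DotrvTheory.
Context (R : realType) (n : nat).

Fact dotrv_is_bilinear : bilinear_for
  (GRing.Scale.Law.clone R R ( *%R ) _)
  (GRing.Scale.Law.clone R R (idfun \; *%R ) _)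
  (@dotrv R n).
Proof.
split=> [v|u] a x y; rewrite /dotrv /= mulr_sumr -big_split /=;
  apply: eq_bigr => i _; rewrite !mxE.
- by rewrite mulrDl mulrA.
- by rewrite mulrDr mulrCA.
Qed.

HB.instance Definition _ := bilinear_isBilinear.Build R _ _ _
  (GRing.Scale.Law.clone R R ( *%R ) _)
  (GRing.Scale.Law.clone R R (idfun \; *%R ) _)
  (@dotrv R n) dotrv_is_bilinear.

Fact dotrv_is_hermitian (u v : 'rV[R]_n) :
  dotrv u v = (-1) ^+ false * idfun (dotrv v u).
Proof.
by rewrite expr0 mul1r /dotrv; apply: eq_bigr => i _; rewrite mulrC.
Qed.

HB.instance Definition _ := @isHermitianSesquilinear.Build R 'rV[R]_n
  false idfun (@dotrv R n) dotrv_is_hermitian.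

Fact dotrv_gt0 (u : 'rV[R]_n) : u != 0 -> 0 < dotrv u u.
Proof.
move=> u_neq0; have sq_ge0 i : 0 <= u 0 i * u 0 i by rewrite -expr2 sqr_ge0.
rewrite lt_neqAle sumr_ge0// andbT eq_sym; apply: contra u_neq0.
rewrite psumr_eq0// => /allP u0; apply/eqP/rowP => i; rewrite mxE.
by have := u0 i (mem_index_enum i); rewrite /= mulf_eq0 orbb => /eqP.
Qed.

HB.instance Definition _ := isDotProduct.Build R 'rV[R]_n (@dotrv R n)
  dotrv_gt0.

End DotrvTheory.

Definition orthc (R : realType) (n : nat) (L : {vspace 'rV[R]_n}) :
  {vspace 'rV[R]_n} := orthov (@dotrv R n) L.

Definition orthproj (R : realType) (n : nat) (W : {vspace 'rV[R]_n}) :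
  'End('rV[R]_n) := daddv_pi W (orthc W).

Definition intvec (R : realType) (n : nat) : set 'rV[R]_n :=
  [set x | forall i, x 0 i \is a Num.int].

Arguments intvec : clear implicits.

Definition minksum (V : zmodType) (A B : set V) : set V :=
  [set x + y | x in A & y in B].

Definition is_lattice (R : realType) (n : nat) (t : nat)
    (Lam : set 'rV[R]_n) : Prop :=
  exists2 a : t.-tuple 'rV[R]_n, free a &
    Lam = [set x | exists l : 'I_t -> int, x = \sum_(i < t) a`_i *~ l i].

(* dim (H `&` Z^n) = dim H, the former being the dimension of a lattice *)
Definition lattice_subspace (R : realType) (n : nat)
    (H : {vspace 'rV[R]_n}) : Prop :=
  is_lattice (\dim H) ([set` H] `&` intvec R n).

Definition minimal_lattice_subspace (R : realType) (n : nat)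
    (L H : {vspace 'rV[R]_n}) : Prop :=
  [/\ lattice_subspace H, (L <= H)%VS &
      forall K : {vspace 'rV[R]_n},
        lattice_subspace K -> (L <= K)%VS -> (K <= H)%VS -> K = H].

(* Main.v *)
Require Import Defs.
From HB Require Import structures.
From mathcomp Require Import all_boot all_order all_algebra sesquilinear.
From mathcomp Require Import all_classical all_reals all_analysis.
From mathcomp Require Import lra.
Set Implicit Arguments.
Unset Strict Implicit.
Unset Printing Implicit Defensive.
Import Order.TTheory GRing.Theory Num.Theory.
Import numFieldNormedType.Exports.
Local Open Scope classical_set_scope.
Local Open Scope ring_scope.

(* Let G be the closure of L + Z^n and V a subspace of maximal dimension inside
   the closed group G. Elements of G close enough to 0 lie in V; since multiples
   of any v in V come arbitrarily close to integer vectors z, and these z then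
   lie in V, the space V is spanned by integer vectors, i.e. it is a lattice
   subspace containing L. A basis of Z^n adapted to H (Smith normal form) shows
   that H + Z^n consists of the points whose coordinates transverse to H are
   integers; hence it is closed and contains no line outside H. So G, and with it
   V, is confined to H + Z^n, V is contained in H, and V = H by minimality.
   Thus H is in G, and projecting to the orthogonal complement of L gives the
   first equality. Lambda is generated by the orthogonal projections, along H, of
   the basis vectors transverse to H. *)

(** * Orthogonal complements and orthogonal projections *)

Section Orthogonality.
Context (R : realType) (n : nat).
Implicit Types L W : {vspace 'rV[R]_n}.

Lemma mem_orthc L x : x \in orthc L <-> {in L, forall v, dotrv x v = 0}.
Proof. by split => /mem_orthovP. Qed.

Lemma dotrvC (u v : 'rV[R]_n) : dotrv u v = dotrv v u.
Proof. by apply: eq_bigr => i _; rewrite mulrC. Qed.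

Lemma capv_orthc L : (L :&: orthc L = 0)%VS.
Proof.
apply/eqP; rewrite -subv0; apply/subvP => v /memv_capP[vL /mem_orthc vL'].
rewrite memv0; apply: contraT => /dotrv_gt0.
by rewrite vL'// ltxx.
Qed.

(** Disjointness of [L] and [orthc L] gives one inequality. For the other, apply rank-nullity to
    [f x], the sum of the [dotrv x b_i *: b_i] over a basis [b] of [L]: its image lies in [L] and,
    as [b] is free, its kernel lies in [orthc L]. *)
Lemma dim_orthc L : (\dim L + \dim (orthc L) = n)%N.
Proof.
have dimE : \dim {:'rV[R]_n} = n by rewrite dimvf /dim /= mul1n.
apply/eqP; rewrite eqn_leq; apply/andP; split.
  by rewrite -dimv_disjoint_sum ?capv_orthc// -[leqRHS]dimE dimvS ?subvf.
pose b := vbasis L; pose B := \matrix_(i < \dim L) b`_i.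
pose f := linfun (mulmxr (B^T *m B) : 'rV[R]_n -> 'rV[R]_n).
have fE x : f x = \sum_(i < \dim L) dotrv x b`_i *: b`_i.
  rewrite lfunE /= mulmxA mulmx_sum_row; apply: eq_bigr => i _.
  rewrite rowK; congr (_ *: _); rewrite mxE; apply: eq_bigr => j _.
  by rewrite !mxE.
have fL : (limg f <= L)%VS.
  apply/subvP => _ /memv_imgP[x _ ->]; rewrite fE.
  by apply: memv_suml => i _; rewrite memvZ// vbasis_mem// mem_nth ?size_tuple.
have kerf : (lker f <= orthc L)%VS.
  apply/subvP => x; rewrite memv_ker fE => /eqP fx0.
  have /freeP b_free := basis_free (vbasisP L).
  apply/mem_orthc => v /coord_vbasis ->.
  rewrite linear_sumr big1// => i _.
  by rewrite linearZr_LR /= (b_free (fun i => dotrv x b`_i))// mulr0.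
rewrite -[leqLHS]dimE -(limg_ker_dim f) addnC capfv leq_add// dimvS//.
Qed.

Lemma addv_orthc L : (L + orthc L = fullv)%VS.
Proof.
apply/eqP; rewrite eqEdim subvf dimv_disjoint_sum ?capv_orthc// dim_orthc.
by rewrite dimvf /dim /= mul1n.
Qed.

Lemma orthcK L : orthc (orthc L) = L.
Proof.
apply/eqP; rewrite eq_sym eqEdim; apply/andP; split.
  apply/subvP => x xL; apply/mem_orthc => v /mem_orthc vL.
  by rewrite dotrvC vL.
by rewrite -(leq_add2r (\dim (orthc L))) dim_orthc addnC dim_orthc.
Qed.

Lemma orthcS L W : (L <= W)%VS -> (orthc W <= orthc L)%VS.
Proof.
by move=> /subvP LW; apply/subvP => x /mem_orthc xW; apply/mem_orthc => v /LW/xW.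
Qed.

Lemma sub_orthproj_mem W x : x - orthproj W x \in orthc W.
Proof.
have xW : x \in (W + orthc W)%VS by rewrite addv_orthc memvf.
rewrite -[X in X - _](daddv_pi_add (capv_orthc W) xW) addrAC subrr add0r.
exact: memv_pi.
Qed.

Lemma orthproj_id W x : x \in W -> orthproj W x = x.
Proof. exact/daddv_pi_id/capv_orthc. Qed.

Lemma orthproj_eq0 W x : x \in orthc W -> orthproj W x = 0.
Proof.
move=> xW; apply/eqP; rewrite -memv0 -(capv_orthc W) memv_cap memv_pi/=.
by rewrite -[X in X \in orthc _](subKr x) rpredB// sub_orthproj_mem.
Qed.

End Orthogonality.

(** * Closures and linear maps in the sup norm *)

Section NormedRows.
Context (R : realType).

Lemma closure_normP (V : normedModType R) (A : set V) x :
  closure A x <-> forall e, 0 < e -> exists2 y, A y & `|x - y| < e.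
Proof.
split=> [clx e e0|H B /nbhs_ballP[e /= e0 eB]].
  have [y [Ay xy]] := clx _ (nbhsx_ballx x e e0).
  by exists y => //; move: xy; rewrite -ball_normE.
by have [y Ay xy] := H _ e0; exists y; split=> //; apply: eB; rewrite -ball_normE.
Qed.

Lemma coord_le_norm n (x : 'rV[R]_n) i : `|x 0 i| <= `|x|.
Proof.
by rewrite [leRHS]/Num.norm /= mx_normrE; apply/bigmax_geP; right; exists (0, i).
Qed.

Lemma norm_lt_coord n (x : 'rV[R]_n) e :
  0 < e -> (forall i, `|x 0 i| < e) -> `|x| < e.
Proof.
move=> e0 xe; rewrite /Num.norm /= mx_normrE; apply/bigmax_ltP; split=> //= -[i j] _ /=.
by rewrite ord1.
Qed.

Lemma linear_lipschitz m n (f : {linear 'rV[R]_m -> 'rV[R]_n}) :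
  exists2 C, 0 < C & forall x, `|f x| <= C * `|x|.
Proof.
(* The summand 1 keeps the constant positive even for [f = 0], so that one may divide by it. *)
exists (1 + \sum_(j < m) `|f 'e_j|); first by rewrite ltr_pwDl ?sumr_ge0.
move=> x; rewrite {1}(row_sum_delta x) linear_sum /=.
rewrite (le_trans (ler_norm_sum _ _ _))// mulrDl mul1r mulr_suml.
rewrite ler_wpDl// ler_sum// => j _.
by rewrite linearZ /= normrZ mulrC ler_wpM2l// coord_le_norm.
Qed.

Lemma closure_linear m n (f : {linear 'rV[R]_m -> 'rV[R]_n})
    (A : set 'rV[R]_m) (B : set 'rV[R]_n) x :
  (forall y, A y -> B (f y)) -> closure A x -> closure B (f x).
Proof.
move=> AB /closure_normP clx; apply/closure_normP => e e0.
have [C C0 fC] := linear_lipschitz f.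
have [y Ay xy] := clx (e / C) (divr_gt0 e0 C0).
exists (f y); first exact: AB.
rewrite -raddfB (le_lt_trans (fC _))//.
by rewrite mulrC -ltr_pdivlMr.
Qed.

(** [V] is the zero set of the linear, hence continuous, map [\1 - projv V]. *)
Lemma closed_vspace n (V : {vspace 'rV[R]_n}) : closed [set` V].
Proof.
move=> x /(@closure_linear _ _ (\1 - projv V)%VF _ [set 0]) H.
have /closure_normP :
    closure ([set 0] : set 'rV[R]_n) ((\1 - projv V)%VF x : 'rV[R]_n).
  by apply: H => y yV /=; rewrite add_lfunE opp_lfunE id_lfunE projv_id// subrr.
rewrite add_lfunE opp_lfunE id_lfunE => {}H.
suff -> : x = projv V x by rewrite /= memv_proj.
apply/eqP; rewrite -subr_eq0; apply: contraT; rewrite -normr_gt0 => /H[_ ->].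
by rewrite subr0 ltxx.
Qed.

End NormedRows.

(** * Integer vectors, lattices as integer row combinations, and Smith normal form *)

Section IntegerVectors.
Context (R : realType).

Local Notation "M ^R" := (map_mx (intr : int -> R) M)
  (at level 8, format "M ^R").

Lemma intvecP n (x : 'rV[R]_n) :
  intvec R n x <-> exists z : 'rV[int]_n, x = z^R.
Proof.
split=> [xZ|[z ->] i]; last by rewrite mxE intr_int.
exists (map_mx Num.floor x); apply/rowP => i.
by rewrite !mxE floorK// xZ.
Qed.

Lemma intvec_map n (z : 'rV[int]_n) : intvec R n z^R.
Proof. by apply/intvecP; exists z. Qed.

Lemma intvec0 n : intvec R n 0.
Proof. by move=> i; rewrite mxE rpred0. Qed.

Lemma intvecD n x y : intvec R n x -> intvec R n y -> intvec R n (x + y).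
Proof. by move=> xZ yZ i; rewrite mxE rpredD. Qed.

Lemma intvecN n x : intvec R n x -> intvec R n (- x).
Proof. by move=> xZ i; rewrite mxE rpredN. Qed.

Lemma intvecB n x y : intvec R n x -> intvec R n y -> intvec R n (x - y).
Proof. by move=> xZ yZ; apply/intvecD/intvecN. Qed.

Lemma intvec_mulmx m n (x : 'rV[R]_m) (M : 'M[int]_(m, n)) :
  intvec R m x -> intvec R n (x *m M^R).
Proof. by move=> /intvecP[z ->]; rewrite -map_mxM; apply: intvec_map. Qed.

Lemma intmx_mulmxV n (U : 'M[int]_n) : U \in unitmx -> U^R *m (invmx U)^R = 1%:M.
Proof. by move=> Uu; rewrite -map_mxM mulmxV// map_mx1. Qed.

Lemma intmx_mulVmx n (U : 'M[int]_n) : U \in unitmx -> (invmx U)^R *m U^R = 1%:M.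
Proof. by move=> Uu; rewrite -map_mxM mulVmx// map_mx1. Qed.

Lemma free_rows n t (a : t.-tuple 'rV[R]_n) :
  free a = row_free (\matrix_(i < t) a`_i).
Proof.
have sumE k : \sum_(i < t) k i *: a`_i = (\row_i k i) *m \matrix_(i < t) a`_i.
  by rewrite mulmx_sum_row; apply: eq_bigr => i _; rewrite mxE rowK.
apply/freeP/idP => [a_free|].
  rewrite -kermx_eq0; apply/eqP/row_matrixP => i; rewrite row0.
  have := @a_free (fun j => kermx (\matrix_(i < t) a`_i) i j).
  rewrite sumE.
  have -> : \row_j kermx (\matrix_(i0 < t) a`_i0) i j
      = row i (kermx (\matrix_(i0 < t) a`_i0)) by apply/rowP => j; rewrite !mxE.
  rewrite -row_mul mulmx_ker row0 => /(_ erefl) k0.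
  by apply/rowP => j; rewrite [RHS]mxE mxE k0.
move=> /row_freeP[C AC] k; rewrite sumE => /(congr1 (mulmx^~ C)).
rewrite -mulmxA AC mulmx1 mul0mx => /rowP k0 i.
by have := k0 i; rewrite !mxE.
Qed.

Lemma lattice_sum_rows n t (a : t.-tuple 'rV[R]_n) (l : 'I_t -> int) :
  \sum_(i < t) a`_i *~ l i = (\row_i l i)^R *m \matrix_(i < t) a`_i.
Proof.
by rewrite mulmx_sum_row; apply: eq_bigr => i _; rewrite !mxE rowK scaler_int.
Qed.

Lemma is_lattice_rows n t (B : 'M[R]_(t, n)) : row_free B ->
  is_lattice t [set x | exists z : 'rV[int]_t, x = z^R *m B].
Proof.
move=> B_free; pose a := [tuple row i B | i < t].
have aE : \matrix_(i < t) a`_i = B.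
  by apply/row_matrixP => i; rewrite rowK -tnth_nth tnth_mktuple.
exists a; first by rewrite free_rows aE.
apply/seteqP; split=> [x [z ->]|x [l ->]] /=.
  by exists (z 0); rewrite (lattice_sum_rows a (z 0)) aE; congr (map_mx _ _ *m _);
    apply/rowP => i; rewrite mxE.
by exists (\row_i l i); rewrite (lattice_sum_rows a l) aE.
Qed.

(* Smith normal form: a subspace spanned by [d] independent integer vectors is
   spanned by [d] vectors of some basis of the lattice of all integer vectors. *)
Lemma adapted_integer_basis d t (V : {vspace 'rV[R]_(d + t)})
    (B : 'M[int]_(d, d + t)) :
  row_free B^R -> (forall x, x \in V <-> exists c, x = c *m B^R) ->
  exists2 U : 'M[int]_(d + t), U \in unitmx &
    forall x, x \in V <-> rsubmx (x *m (invmx U)^R) = 0.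
Proof.
have [P Pu [U Uu [s _ defB]]] := int_Smith_normal_form B.
move=> B_free VE; exists U => // x.
pose D : 'M[int]_d := \matrix_(i, j) (s`_i *+ (i == j)).
(* The Smith form reads [B = P (D | 0) U], so the rows of [B] are combinations of the first [d] rows
   of [U]. *)
have BE : B^R = (P *m D)^R *m row_mx 1%:M 0 *m U^R.
  rewrite {1}defB !map_mxM -mulmxA -[in RHS]mulmxA -[in RHS]mulmxA.
  congr (_ *m _); rewrite mulmxA; congr (_ *m _).
  rewrite mul_mx_row mulmx1 mulmx0; apply/matrixP => i j.
  case: (split_ordP j) => k ->; rewrite ?row_mxEl ?row_mxEr !mxE//.
  by rewrite /= ltn_eqF// ltn_addr.
(* Full rank of [B] makes [P D] invertible over the reals, though perhaps not over the integers; so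
   the first [d] rows of [U] have the same real span as [B]. *)
have Qu : (P *m D)^R \in unitmx.
  rewrite -row_free_unit -row_leq_rank -[leqLHS](eqP B_free) BE -mulmxA.
  exact: mxrankM_maxl.
have UK := intmx_mulmxV Uu; have UKV := intmx_mulVmx Uu.
split=> [/VE[c ->]|x0].
  by rewrite BE -!mulmxA UK mulmx1 !mul_mx_row !mulmx0 row_mxKr.
apply/VE; exists (lsubmx (x *m (invmx U)^R) *m invmx (P *m D)^R).
rewrite BE -!mulmxA mulKmx// mulmxA mul_mx_row mulmx1 mulmx0 -x0 hsubmxK.
by rewrite -mulmxA UKV mulmx1.
Qed.

End IntegerVectors.

(** * Bases of the integer lattice adapted to a subspace *)

Section AdaptedBases.
Context (R : realType).

Local Notation "M ^R" := (map_mx (intr : int -> R) M)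
  (at level 8, format "M ^R").

(* The last [t] coordinates of [x] in the basis formed by the rows of [U]. *)
Definition tail_coord d t (U : 'M[int]_(d + t)) (x : 'rV[R]_(d + t)) : 'rV[R]_t :=
  rsubmx (x *m (invmx U)^R).

(** The rows of [U] form a basis of the integer lattice whose first [d] members form a basis of
    [V]. *)
Definition adapted d t (V : {vspace 'rV[R]_(d + t)}) (U : 'M[int]_(d + t)) :=
  U \in unitmx /\ forall x, x \in V <-> tail_coord U x = 0.

Fact tail_coord_is_linear d t (U : 'M[int]_(d + t)) : linear (tail_coord U).
Proof. by move=> a x y; rewrite /tail_coord mulmxDl -scalemxAl linearP. Qed.

HB.instance Definition _ d t (U : 'M[int]_(d + t)) :=
  GRing.isLinear.Build R 'rV[R]_(d + t) 'rV[R]_t _ (tail_coord U)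
    (tail_coord_is_linear U).

Lemma tail_coord_int d t (U : 'M[int]_(d + t)) x :
  intvec R _ x -> intvec R t (tail_coord U x).
Proof. by move=> xZ i; rewrite mxE; apply: intvec_mulmx. Qed.

(** The last [t] rows of [U] provide a linear section of [tail_coord U], which sends integer tails
    to integer vectors. *)
Lemma tail_coord_dsubmx d t (U : 'M[int]_(d + t)) (c : 'rV[R]_t) :
  U \in unitmx -> tail_coord U (c *m dsubmx U^R) = c.
Proof.
move=> Uu; have -> : c *m dsubmx U^R = row_mx 0 c *m U^R.
  by rewrite -[in RHS](vsubmxK U^R) mul_row_col mul0mx add0r.
by rewrite /tail_coord -mulmxA intmx_mulmxV// mulmx1 row_mxKr.
Qed.

Lemma adapted_of_free d t (V : {vspace 'rV[R]_(d + t)})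
    (a : d.-tuple 'rV[R]_(d + t)) :
  \dim V = d -> free a -> (forall i : 'I_d, a`_i \in V) ->
  (forall i : 'I_d, intvec R _ a`_i) -> exists U, adapted V U.
Proof.
move=> dimV a_free aV aZ.
have a_basis : basis_of V a.
  rewrite basisEfree a_free size_tuple dimV leqnn andbT/=.
  by apply/span_subvP => x /(nthP 0)[i]; rewrite size_tuple => id <-;
    have := aV (Ordinal id).
pose B : 'M[int]_(d, d + t) := \matrix_(i, j) Num.floor (a`_i 0 j).
have BE : B^R = \matrix_(i < d) a`_i.
  by apply/matrixP => i j; rewrite !mxE floorK// aZ.
have [||U Uu VU] := @adapted_integer_basis R d t V B; last by exists U.
  by rewrite BE -free_rows.
move=> x; rewrite BE; split=> [/(coord_basis a_basis) ->|[c ->]].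
  exists (\row_i coord a i x); rewrite mulmx_sum_row.
  by apply: eq_bigr => i _; rewrite mxE rowK.
by rewrite mulmx_sum_row; apply: memv_suml => i _; rewrite rowK memvZ.
Qed.

Lemma lattice_subspace_adapted d t (V : {vspace 'rV[R]_(d + t)}) :
  \dim V = d -> lattice_subspace V -> exists U, adapted V U.
Proof.
rewrite /lattice_subspace => dimV; rewrite dimV => -[a a_free VE].
have aV i : ([set` V] `&` intvec R (d + t)) a`_(i : 'I_d).
  rewrite VE; exists (fun j => (i == j)%:R).
  by rewrite (bigD1 i)//= big1 ?eqxx ?addr0// => j /negbTE; rewrite eq_sym => ->.
by apply: (adapted_of_free dimV a_free) => i; have [] := aV i.
Qed.

(** Since [invmx U] is integral, integer points have integer coordinates in the basis [U]; those in
    [V] are thus the integer combinations of its first [d] rows. *)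
Lemma adapted_lattice_subspace d t (V : {vspace 'rV[R]_(d + t)}) U :
  \dim V = d -> adapted V U -> lattice_subspace V.
Proof.
move=> dimV [Uu VE].
have UK := intmx_mulmxV R Uu; have UKV := intmx_mulVmx R Uu.
rewrite /lattice_subspace dimV.
suff -> : [set` V] `&` intvec R (d + t)
    = [set x | exists z : 'rV[int]_d, x = z^R *m usubmx U^R].
  apply: is_lattice_rows; apply/row_freeP; exists (lsubmx (invmx U)^R).
  apply/matrixP => i j; have /matrixP/(_ (lshift t i) (lshift t j)) := UK.
  rewrite !mxE (inj_eq (@lshift_inj _ _)) => <-.
  by apply: eq_bigr => k _; rewrite !mxE.
apply/seteqP; split=> x /=.
  move=> [/VE x0 /intvecP[z xz]]; rewrite {}xz in x0 *; exists (lsubmx (z *m invmx U)).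
  have {1}-> : z^R = row_mx (lsubmx (z^R *m (invmx U)^R)) 0 *m U^R.
    by rewrite -[X in row_mx _ X]x0 /tail_coord hsubmxK -mulmxA UKV mulmx1.
  rewrite -{1}(vsubmxK U^R) mul_row_col mul0mx addr0 -map_mxM.
  by congr (_ *m _); apply/matrixP => i j; rewrite !mxE.
move=> [z ->]; have -> : z^R *m usubmx U^R = (row_mx z 0)^R *m U^R.
  by rewrite map_row_mx map_mx0 -[in RHS](vsubmxK U^R) mul_row_col mul0mx addr0.
split; last exact/intvec_mulmx/intvec_map.
by apply/VE; rewrite /tail_coord -mulmxA UK mulmx1 map_row_mx map_mx0 row_mxKr.
Qed.

(** Subtracting the integer combination of the last rows of [U] with the same tail leaves a point of
    [V]. Closedness and the absence of further lines are read off this description. *)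
Lemma minksum_adapted d t (V : {vspace 'rV[R]_(d + t)}) U x : adapted V U ->
  minksum [set` V] (intvec R _) x <-> intvec R t (tail_coord U x).
Proof.
move=> [Uu VE]; split=> [[v /VE v0 [z zZ <-]]|/intvecP[z xz]].
  by rewrite linearD /= v0 add0r; apply: tail_coord_int.
exists (x - z^R *m dsubmx U^R).
  by apply/VE; rewrite linearB /= tail_coord_dsubmx// xz subrr.
exists (z^R *m dsubmx U^R); last by rewrite subrK.
have -> : dsubmx U^R = (dsubmx U)^R by apply/matrixP => i j; rewrite !mxE.
exact/intvec_mulmx/intvec_map.
Qed.

Lemma int_norm_lt1 n (x : 'rV[R]_n) : intvec R n x -> `|x| < 1 -> x = 0.
Proof.
move=> xZ x1; apply/rowP => i; rewrite [RHS]mxE; apply/eqP; apply: contraT.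
move=> /(norm_intr_ge1 (xZ i)); rewrite leNgt.
by rewrite (le_lt_trans (coord_le_norm _ _) x1).
Qed.

Lemma closed_intvec n : closed (intvec R n).
Proof.
move=> x /closure_normP clx.
have [y yZ xy] := clx (2^-1) ltac:(by rewrite invr_gt0).
suff -> : x = y by [].
apply/eqP; rewrite -subr_eq0 -normr_le0 leNgt; apply/negP => e0.
(* If [x] differed from [y], some integer point [z] would be strictly closer to [x]; but [y] and [z]
   are both within 1/2 of [x], which forces [y = z]. *)
have [|z zZ xz] := clx (Num.min `|x - y| 2^-1).
  by rewrite lt_min e0 invr_gt0/=.
have yz : y - z = 0.
  apply: int_norm_lt1; first exact: intvecB.
  rewrite -(subrK x y) -addrA (le_lt_trans (ler_normD _ _))//.
  rewrite distrC (splitr 1) mul1r ltrD//.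
  by move: xz; rewrite lt_min => /andP[].
by move: xz; rewrite lt_min -(subr0_eq yz) ltxx.
Qed.

Lemma closed_minksum_adapted d t (V : {vspace 'rV[R]_(d + t)}) U :
  adapted V U -> closed (minksum [set` V] (intvec R (d + t))).
Proof.
move=> VU x clx; apply/(minksum_adapted _ VU)/closed_intvec.
by apply: closure_linear clx => y /(minksum_adapted _ VU).
Qed.

Lemma line_minksum_adapted d t (V : {vspace 'rV[R]_(d + t)}) U x :
  adapted V U -> (forall s : R, minksum [set` V] (intvec R (d + t)) (s *: x)) ->
  x \in V.
Proof.
move=> VU xV; case: (VU) => _ ->; apply/rowP => i; rewrite [RHS]mxE.
apply/eqP; apply: contraT => y0.
(* This scaling turns the nonzero tail coordinate into 1/2, which is not an integer. *)
have /(minksum_adapted _ VU)/(_ i) := xV (2 * tail_coord U x 0 i)^-1.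
rewrite linearZ /= mxE invfM -mulrA mulVf// mulr1.
move=> /norm_intr_ge1; rewrite invr_eq0 pnatr_eq0 => /(_ isT).
by rewrite ger0_norm ?invr_ge0// invf_ge1// lern1.
Qed.

(** The projection [p] onto [orthc H] changes a vector only by an element of [H], so it preserves
    tails, and its values lie in [orthc L] because [L <= H]. Hence the projected last rows of [U]
    stay independent and realise every integer tail inside [orthc L]. *)
Lemma lattice_complement d t (L H : {vspace 'rV[R]_(d + t)}) U :
  \dim H = d -> adapted H U -> (L <= H)%VS ->
  exists Lam : set 'rV[R]_(d + t),
    [/\ is_lattice t Lam,
        Lam `<=` [set` orthc L],
        minksum [set` H] (intvec R (d + t)) `&` [set` orthc L]
          = minksum [set` (H :&: orthc L)%VS] Lam &
        (\dim (H :&: orthc L) + t = \dim (orthc L))%N].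
Proof.
move=> dimH HU LH; have [Uu HE] := HU.
pose p := orthproj (orthc H).
pose B := \matrix_(i < t) p (row i (dsubmx U^R)).
have BE c : c *m B = p (c *m dsubmx U^R).
  rewrite !mulmx_sum_row linear_sum; apply: eq_bigr => i _.
  by rewrite linearZ rowK.
have pH x : x - p x \in H by have := sub_orthproj_mem (orthc H) x; rewrite orthcK.
have pL x : p x \in orthc L by apply: (subvP (orthcS LH)); apply: memv_pi.
have B_free : row_free B.
  apply: inj_row_free => c; rewrite BE => pc0.
  have := pH (c *m dsubmx U^R).
  by rewrite pc0 subr0 => /HE; rewrite tail_coord_dsubmx.
exists [set x | exists z : 'rV[int]_t, x = z^R *m B]; split.
- exact: is_lattice_rows.
- by move=> _ [z ->]; rewrite BE /= pL.
- apply/seteqP; split=> x /=.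
    move=> [/(minksum_adapted _ HU)/intvecP[z xz] xL].
    exists (x - z^R *m B); last by exists (z^R *m B); [exists z | rewrite subrK].
    rewrite /= memv_cap BE; apply/andP; split; last exact: rpredB.
    rewrite -(subrK (z^R *m dsubmx U^R) x) -addrA rpredD ?pH//.
    by apply/HE; rewrite linearB /= tail_coord_dsubmx// xz subrr.
  move=> [h /memv_capP[hH hL] [_ [z ->] <-]]; rewrite BE rpredD ?pL//; split=> //.
  apply/(minksum_adapted _ HU); rewrite linearD /=.
  have -> : tail_coord U (p (z^R *m dsubmx U^R)) = z^R.
    have /HE/eqP := pH (z^R *m dsubmx U^R).
    by rewrite linearB /= tail_coord_dsubmx// subr_eq0 => /eqP.
  by have /HE -> := hH; rewrite add0r; apply: intvec_map.
(* As [H] contains [L], it spans the whole space together with [orthc L]; the dimension formula for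
   sums then gives the count. *)
have HLf : (H + orthc L = fullv)%VS.
  by apply/eqP; rewrite eqEsubv subvf -(addv_orthc L) addvS.
have := dimv_sum_cap H (orthc L).
rewrite HLf dimvf /dim /= mul1n dimH -addnA => /addnI <-.
by rewrite addnC.
Qed.
End AdaptedBases.

(** * Closed subgroups and the subspaces they contain *)

Section ClosedSubgroups.
Context (R : realType).

Definition subgroup (V : zmodType) (G : set V) :=
  G 0 /\ forall x y, G x -> G y -> G (x - y).

Lemma subgroupD (V : zmodType) (G : set V) x y :
  subgroup G -> G x -> G y -> G (x + y).
Proof. by move=> [G0 GB] Gx Gy; rewrite -(opprK y) -(sub0r y); apply/GB/GB. Qed.

Lemma subgroupMz (V : zmodType) (G : set V) x (k : int) :
  subgroup G -> G x -> G (x *~ k).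
Proof.
move=> GG Gx; have [G0 GB] := GG; have Gn m : G (x *+ m).
  elim: m => [|m IHm]; first by rewrite mulr0n.
  by rewrite mulrS; apply: subgroupD.
case: k => m; first exact: Gn.
by rewrite NegzE mulrNz -sub0r; apply: GB => //; apply: Gn.
Qed.

Lemma subgroup_closure (V : normedModType R) (G : set V) :
  subgroup G -> subgroup (closure G).
Proof.
move=> [G0 GB]; split; first exact: subset_closure.
move=> x y /closure_normP clx /closure_normP cly; apply/closure_normP => e e0.
have [a Ga xa] := clx _ (divr_gt0 e0 (ltr0n R 2)).
have [b Gb yb] := cly _ (divr_gt0 e0 (ltr0n R 2)).
exists (a - b); first exact: GB.
have -> : x - y - (a - b) = (x - a) - (y - b) by rewrite !opprD addrACA.
by rewrite (le_lt_trans (ler_normB _ _))// (splitr e) ltrD.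
Qed.

Lemma subgroup_minksum n (L : {vspace 'rV[R]_n}) :
  subgroup (minksum [set` L] (intvec R n)).
Proof.
split.
  by exists 0; [rewrite /= mem0v | exists 0; [exact: intvec0 | rewrite addr0]].
move=> _ _ [x xL [y yZ <-]] [x' xL' [y' yZ' <-]].
exists (x - x'); first exact: rpredB.
by exists (y - y'); [exact: intvecB | rewrite opprD addrACA].
Qed.

(** Take [V] of largest dimension inside [G]: a line in [G] outside [V] could be added to it, since
    [G] is closed under sums. *)
Lemma maximal_subspace n (G : set 'rV[R]_n) : subgroup G ->
  exists V : {vspace 'rV[R]_n}, [set` V] `<=` G /\
    forall u, (forall s : R, G (s *: u)) -> u \in V.
Proof.
move=> GG.
pose P (k : nat) := `[< exists V : {vspace 'rV[R]_n}, [set` V] `<=` G /\ \dim V = k >].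
have P0 : exists k, P k.
  exists 0%N; apply/asboolP; exists 0%VS; rewrite dimv0; split=> // x /=.
  by rewrite memv0 => /eqP ->; case: GG.
have Pmax k : P k -> (k <= \dim {:'rV[R]_n})%N.
  by move=> /asboolP[V [_ <-]]; rewrite dimvS ?subvf.
have [k /asboolP[V [VG dimV]] kmax] := ex_maxnP P0 Pmax.
exists V; split=> // u uG; apply: contraT => uV.
have : P (\dim (V + <[u]>)).
  apply/asboolP; exists (V + <[u]>)%VS; split=> // x /memv_addP[v vV [w /vlineP[s ->] ->]].
  exact/(subgroupD GG)/uG/VG.
move=> /kmax; rewrite -dimV leqNgt => /negP[].
rewrite ltn_neqAle dimvS ?addvSl// andbT.
apply: contra uV => /eqP dimE.
have /eqP -> : (V == V + <[u]>)%VS by rewrite eqEdim addvSl dimE leqnn.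
exact: (subvP (addvSr _ _) _ (memv_line u)).
Qed.

Lemma compact_unit_sphere n (W : {vspace 'rV[R]_n}) :
  compact [set x | x \in W /\ `|x| = 1].
Proof.
apply: bounded_closed_compact.
  by exists 1; split; [rewrite num_real | move=> M M1 x /= [_ x1]; apply: ltW; rewrite x1].
move=> x clx; split.
  by apply: closed_vspace; apply: closureS clx => y [].
apply/eqP; rewrite -subr_eq0 -normr_le0 leNgt; apply/negP => e0.
have /closure_normP/(_ _ e0)[y [_ y1]] := clx.
by rewrite -{1}y1 ltNge ler_dist_dist.
Qed.

(* Otherwise the directions of small elements of [G] in [W] accumulate at a
   unit vector [p], and integer multiples of these elements approximate every
   point of the line through [p], which therefore lies in [G]. *)
Lemma subgroup_isolated0 n (G : set 'rV[R]_n) (W : {vspace 'rV[R]_n}) :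
  subgroup G -> closed G ->
  (forall u, u \in W -> (forall s : R, G (s *: u)) -> u = 0) ->
  exists2 e, 0 < e & forall g, g \in W -> G g -> `|g| < e -> g = 0.
Proof.
move=> GG Gcl Wline; apply: contrapT => noe.
have small k : exists g, [/\ g \in W, G g, g != 0 & `|g| < k.+1%:R^-1].
  apply: contrapT => nog; apply: noe; exists k.+1%:R^-1; first by rewrite invr_gt0.
  move=> g gW Gg ge; apply/eqP; apply: contraT => g0.
  by exfalso; apply: nog; exists g.
have [g gP] := choice small.
pose u k := `|g k|^-1 *: g k.
have FA : (u @ \oo) [set x | x \in W /\ `|x| = 1].
  exists 0%N => // k _ /=; have [gW _ g0 _] := gP k; split; first exact: memvZ.
  by rewrite normrZ normfV normr_id mulVf// normr_eq0.
have [p [[pW p1] pcl]] := @compact_unit_sphere n W (u @ \oo) _ FA.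
suff p0 : p = 0 by move: p1; rewrite p0 normr0 => /eqP; rewrite eq_sym oner_eq0.
apply: Wline => // s; apply: Gcl; apply/closure_normP => e e0.
have e20 : 0 < e / 2 by rewrite divr_gt0.
have s0 : 0 < 1 + `|s| by rewrite ltr_pwDl.
(* From index [N] on, [g k] has norm below [e / 2]. The ball radius below makes the direction error,
   multiplied by the norm of [s], at most [e / 2]; the added 1 covers [s = 0]. *)
pose N := Num.truncn (e / 2)^-1.
have [] := pcl [set u k | k in [set k | (N <= k)%N]] (ball p (e / 2 / (1 + `|s|))).
- by exists N => // k Nk; exists k.
- by apply: nbhsx_ballx; rewrite divr_gt0.
move=> _ [[k /= Nk <-]]; rewrite -ball_normE /= => puk.
have [gW Gg g0 gk] := gP k.
have gk2 : `|g k| < e / 2.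
  apply: (lt_trans gk); rewrite invf_plt ?posrE//.
  have /andP[_ /lt_le_trans->//] := truncn_itv (ltW (etrans (invr_gt0 _) e20)).
  by rewrite ler_nat ltnS.
(* Taking [m] copies of [g k] gives [s *: u k] up to a rounding error of at most the norm of
   [g k]. *)
pose m := Num.floor (s / `|g k|).
exists (g k *~ m); first exact: subgroupMz.
rewrite (_ : _ - _ = s *: (p - u k) + (s / `|g k| - m%:~R) *: g k); last first.
  by rewrite scalerBr scalerA scalerBl scaler_int addrA subrK.
rewrite (le_lt_trans (ler_normD _ _))// (splitr e) ler_ltD// normrZ.
  rewrite (@le_trans _ _ ((1 + `|s|) * `|p - u k|))// ?ler_wpM2r ?ler_wpDl//.
  by rewrite mulrC -ler_pdivlMr// ltW.
rewrite (le_lt_trans _ gk2)// ler_piMl//.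
have /andP[mle mlt] := floor_itv (s / `|g k|).
rewrite ger0_norm ?subr_ge0// lerBlDl ltW//.
by move: mlt; rewrite intrD.
Qed.

(** Split [g] along [V] and its complement [V^C]. The second component is again in [G], because [V]
    is, and is small by the Lipschitz bound; no line of [G] lies in [V^C], so 0 is isolated there
    and this component vanishes. *)
Lemma small_subgroup_subspace n (G : set 'rV[R]_n) (V : {vspace 'rV[R]_n}) :
  subgroup G -> closed G -> [set` V] `<=` G ->
  (forall u, (forall s : R, G (s *: u)) -> u \in V) ->
  exists2 e, 0 < e & forall g, G g -> `|g| < e -> g \in V.
Proof.
move=> GG Gcl VG Vmax.
have [|e e0 eG] := @subgroup_isolated0 n G V^C GG Gcl.
  move=> u uVC /Vmax uV; apply/eqP; rewrite -memv0 -(capv_compl V) memv_cap.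
  by rewrite uV.
have [C C0 fC] := linear_lipschitz (daddv_pi V^C V).
exists (e / C); first by rewrite divr_gt0.
move=> g Gg ge; have gE : projv V g + daddv_pi V^C V g = g.
  by apply: daddv_pi_add; rewrite ?capv_compl ?addv_complf ?memvf.
suff g0 : daddv_pi V^C V g = 0 by rewrite -gE g0 addr0 memv_proj.
apply: eG; first exact: memv_pi.
  have -> : daddv_pi V^C V g = g - projv V g by rewrite -{2}gE addrAC subrr add0r.
  by case: GG => _; apply=> //; apply: VG; rewrite /= memv_proj.
by rewrite (le_lt_trans (fC _))// mulrC -ltr_pdivlMr.
Qed.

(* Dirichlet's pigeonhole argument on the fractional parts of the [v *+ k]. *)
Lemma simultaneous_approximation n (v : 'rV[R]_n) (e : R) : 0 < e ->
  exists k z, [/\ (0 < k)%N, intvec R n z & `|v *+ k - z| < e].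
Proof.
move=> e0; pose N := Num.truncn e^-1.
have Ne : N.+1%:R^-1 < e.
  rewrite invf_plt ?posrE//.
  by have /andP[] := truncn_itv (ltW (etrans (invr_gt0 _) e0)).
pose fl k i : int := Num.floor (v 0 i *+ k).
pose fr k i : R := v 0 i *+ k - (fl k i)%:~R.
pose cell k i := Num.truncn (N.+1%:R * fr k i).
have fr_ge0 k i : 0 <= fr k i by rewrite subr_ge0 floor_le_tmp.
have frN_ge0 k i : 0 <= N.+1%:R * fr k i by rewrite mulr_ge0.
have cell_lt k i : (cell k i < N.+1)%N.
  rewrite -(ltr_nat R); have /andP[/le_lt_trans-> //] := truncn_itv (frN_ge0 k i).
  rewrite gtr_pMr// ltrBlDl.
  by have /andP[_] := floor_itv (v 0 i *+ k); rewrite intrD.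
pose T := {ffun 'I_n -> 'I_N.+1}.
(* There is one more multiple than there are boxes of side [1 / (N + 1)], so two multiples share a
   box. *)
pose f (k : 'I_#|T|.+1) : T := [ffun i => Ordinal (cell_lt k i)].
have /injectivePn[k1 [k2 k12 fk]] : ~~ injectiveb f.
  by apply/injectiveP => /leq_card; rewrite card_ord ltnn.
wlog lt12 : k1 k2 k12 fk / (k1 < k2)%N.
  move=> H; move: (k12); rewrite -val_eqE neq_ltn => /orP[]; first exact: H k12 fk.
  by move=> lt21; apply: (H k2 k1) => //; rewrite eq_sym.
(* Subtracting the two multiples and their integer parts leaves a difference of fractional parts
   from the same box. *)
exists (k2 - k1)%N, (\row_i (fl k2 i - fl k1 i)%:~R); split.
- by rewrite subn_gt0.
- by move=> i; rewrite mxE intr_int.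
apply: norm_lt_coord => // i; apply: le_lt_trans Ne.
have -> : (v *+ (k2 - k1) - \row_i (fl k2 i - fl k1 i)%:~R) 0 i = fr k2 i - fr k1 i.
  rewrite !mxE mulmxnE mulrnBr ?(ltnW lt12)// intrB /fr !opprD.
  by rewrite addrACA.
have cE : cell k1 i = cell k2 i by have /ffunP/(_ i) := fk; rewrite !ffunE => -[].
have /andP[l1 u1] := truncn_itv (frN_ge0 k1 i).
have /andP[l2 u2] := truncn_itv (frN_ge0 k2 i).
move: l1 u1; rewrite -/(cell k1 i) cE => l1 u1.
rewrite -[leRHS]mul1r ler_pdivlMr// -[X in _ * X]ger0_norm// -normrM ltW//.
rewrite mulrBl mulrC [fr k1 i * _]mulrC ltr_norml.
move: l1 u1 l2 u2; rewrite -/(cell k2 i) -natr1 => l1 u1 l2 u2.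
by rewrite ltrBrDl ltrBlDl; apply/andP; split; lra.
Qed.

(** Take a largest free family [a] of integer vectors in [V]. Every [v] in [V] is a limit of vectors
    [z / m] with [z] an integer vector in [V]; maximality puts [z] in the span of [a], and that span
    is closed. *)
Lemma integer_spanned n (G : set 'rV[R]_n) (V : {vspace 'rV[R]_n}) e :
  subgroup G -> intvec R n `<=` G -> [set` V] `<=` G ->
  0 < e -> (forall g, G g -> `|g| < e -> g \in V) ->
  exists a : (\dim V).-tuple 'rV[R]_n,
    free a /\ forall i : 'I_(\dim V), a`_i \in V /\ intvec R n a`_i.
Proof.
move=> GG ZG VG e0 eG.
pose Q x := x \in V /\ intvec R n x.
pose P (k : nat) := `[< exists a : k.-tuple 'rV[R]_n, free a /\ forall i : 'I_k, Q a`_i >].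
have P0 : exists k, P k.
  exists 0%N; apply/asboolP; exists [tuple]; split; first exact: nil_free.
  by case.
have aV k (a : k.-tuple 'rV[R]_n) : (forall i : 'I_k, Q a`_i) -> (<<a>> <= V)%VS.
  move=> aQ; apply/span_subvP => x /(nthP 0)[i]; rewrite size_tuple => ik <-.
  by have [] := aQ (Ordinal ik).
have Pmax k : P k -> (k <= \dim V)%N.
  move=> /asboolP[a [/eqP a_free /aV]] /dimvS.
  by rewrite a_free size_tuple.
have [k Pk kmax] := ex_maxnP P0 Pmax.
have /asboolP[a [a_free aQ]] := Pk.
suff Va : (V <= <<a>>)%VS.
  suff kE : k = \dim V by move: a a_free aQ {Va Pk kmax}; rewrite kE => a; exists a.
  apply/eqP; rewrite eqn_leq Pmax//= (leq_trans (dimvS Va))//.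
  by rewrite (eqP a_free) size_tuple.
apply/subvP => v vV; apply: (@closed_vspace _ _ <<a>>%VS).
apply/closure_normP => d d0.
(* The bound [e] forces [v *+ m - z], an element of [G], into [V], and so [z] too; the bound [d]
   makes [z / m] close to [v]. *)
have [|m [z [m0 zZ vmz]]] := @simultaneous_approximation n v (Num.min d e).
  by rewrite lt_min d0.
move: vmz; rewrite lt_min => /andP[vmd vme].
have zV : z \in V.
  rewrite -(subKr (v *+ m) z) rpredB ?rpredMn//; apply: eG => //.
  by case: (GG) => _; apply; [apply/VG/rpredMn | apply: ZG].
have za : z \in <<a>>%VS.
  apply: contraT => za; suff : P k.+1 by move=> /kmax; rewrite ltnn.
  apply/asboolP; exists [tuple of z :: a]; split; first by rewrite free_cons za.
  move=> i; case: (unliftP ord0 i) => [j|] -> //.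
  exact: aQ.
exists (m%:R^-1 *: z); first exact: memvZ.
apply: le_lt_trans vmd.
have mR0 : (m%:R : R) != 0 by rewrite pnatr_eq0 -lt0n.
rewrite -{1}(scalerK mR0 v) -scalerBr scaler_nat normrZ ler_piMl//.
by rewrite normfV normr_nat invf_le1 ?ltr0n// ler1n.
Qed.

Lemma lattice_subspace_of_free n (V : {vspace 'rV[R]_n})
    (a : (\dim V).-tuple 'rV[R]_n) : free a ->
  (forall i : 'I_(\dim V), a`_i \in V /\ intvec R n a`_i) -> lattice_subspace V.
Proof.
have [t nE] : exists t, n = (\dim V + t)%N.
  by exists (\dim (orthc V)); rewrite dim_orthc.
have [d dE] : exists d, d = \dim V by exists (\dim V).
(* The ambient dimension must have the literal form [d + t] for adapted bases to be stated. *)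
move: a; rewrite -dE in nE *; subst n => a a_free aQ.
have [] := @adapted_of_free R d t V a (esym dE) a_free.
- by move=> i; have [] := aQ i.
- by move=> i; have [] := aQ i.
by move=> U; apply: adapted_lattice_subspace.
Qed.

(** Supplies the subspace that minimality will identify with [H]. It contains [L] because every line
    through 0 in [L] lies in the closed group. *)
Lemma lattice_subspace_in_closure n (L : {vspace 'rV[R]_n}) :
  exists V : {vspace 'rV[R]_n}, [/\ lattice_subspace V, (L <= V)%VS &
    [set` V] `<=` closure (minksum [set` L] (intvec R n))].
Proof.
set G := closure _.
have LG0 x : x \in L -> G x.
  move=> xL; apply: subset_closure; exists x => //.
  by exists 0; [exact: intvec0 | rewrite addr0].
have ZG : intvec R n `<=` G.
  move=> z zZ; apply: subset_closure; exists 0; first by rewrite /= mem0v.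
  by exists z; rewrite ?add0r.
have GG : subgroup G by apply/subgroup_closure/subgroup_minksum.
have Gcl : closed G by exact: closed_closure.
have [V [VG Vmax]] := maximal_subspace GG.
have [e e0 eG] := small_subgroup_subspace GG Gcl VG Vmax.
have [a [a_free aQ]] := integer_spanned GG ZG VG e0 eG.
exists V; split => //; first exact: lattice_subspace_of_free a_free aQ.
by apply/subvP => x xL; apply: Vmax => s; apply/LG0/memvZ.
Qed.

End ClosedSubgroups.

Theorem proposition4p8 (R : realType) (n : nat) (L H : {vspace 'rV[R]_n})
    (minH : minimal_lattice_subspace L H) :
  closure (orthproj (orthc L) @` intvec R n)
    = minksum [set` H] (intvec R n) `&` [set` orthc L]
  /\ exists (t : nat) (Lam : set 'rV[R]_n),
      [/\ is_lattice t Lam,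
          Lam `<=` [set` orthc L],
          minksum [set` H] (intvec R n) `&` [set` orthc L]
            = minksum [set` (H :&: orthc L)%VS] Lam &
          (\dim (H :&: orthc L) + t = \dim (orthc L))%N].
Proof.
have [latH LH Hmin] := minH.
have [t nE] : exists t, n = (\dim H + t)%N.
  by exists (\dim (orthc H)); rewrite dim_orthc.
have [d dimH] : exists d, \dim H = d by exists (\dim H).
rewrite dimH in nE; subst n.
have [U HU] := lattice_subspace_adapted dimH latH.
have HZcl := closed_minksum_adapted HU.
split; last by exists t; apply: lattice_complement dimH HU LH.
(* The subspace [V] lies in the closed set [H + Z^n], so its lines lie in [H]; then [V <= H], and
   minimality gives [V = H]. *)
have HG : [set` H] `<=` closure (minksum [set` L] (intvec R (d + t))).
  have [V [latV LV VG]] := lattice_subspace_in_closure L.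
  rewrite -(Hmin V latV LV)//; apply/subvP => x xV.
  apply: (line_minksum_adapted HU) => s; apply: HZcl.
  apply: closureS (VG _ (memvZ s xV)) => _ [v vL [z zZ <-]].
  by exists v; [apply: (subvP LH) | exists z].
apply/seteqP; split=> [x clx|x [[h hH [z zZ <-]] xL]].
  split; last first.
    by apply: closed_vspace; apply: closureS clx => _ [z _ <-]; apply: memv_pi.
  apply: HZcl; apply: closureS clx => _ [z zZ <-].
  (* An integer vector and its projection differ by an element of [L], hence of [H]. *)
  exists (orthproj (orthc L) z - z); last by exists z; rewrite ?subrK.
  rewrite /= -opprB rpredN; apply: (subvP LH).
  by have := sub_orthproj_mem (orthc L) z; rewrite orthcK.
(* Now [x = h + z] is its own projection and a limit of points [l + w + z] with [l] in [L] and [w]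
   integral; these project to the same points as the integer vectors [w + z]. *)
rewrite -(orthproj_id xL).
apply: (@closure_linear _ _ _ _ [set y + z | y in minksum [set` L] (intvec R _)]).
  move=> _ [_ [l lL [w wZ <-]] <-]; exists (w + z); first exact: intvecD.
  by rewrite -addrA [RHS]linearD /= (@orthproj_eq0 _ _ _ l) ?orthcK// add0r.
apply/closure_normP => e e0.
have /closure_normP/(_ _ e0)[y yA hy] := HG h hH.
by exists (y + z); [exists y | rewrite opprD addrACA subrr addr0].
Qed.
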